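(* Let $\mathcal{H}$ be a complex Hilbert space and $V:G\to\mathcal{U}(\mathcal{H})$ a strongly continuous unitary representation of a group $G$. Let $Q$ be a closed, semibounded quadratic form with dense domain $\mathcal{D}\subset\mathcal{H}$ and let $T$ be the semibounded, self-adjoint operator representing $Q$. Then the quadratic form $Q$ is $G$-invariant if and only if the operator $T$ is $G$-invariant.
   Context: A quadratic form $Q$ on a dense subspace $\mathcal{D}$ is given by a Hermitian sesquilinear form $Q:\mathcal{D}\times\mathcal{D}\to\mathbb{C}$ (antilinear in the first argument), with $Q(\Phi):=Q(\Phi,\Phi)$. It is semibounded from below (resp. above) if there is $a>0$ with $Q(\Phi)\ge-a\|\Phi\|^2$ (resp. $Q(\Phi)\le a\|\Phi\|^2$) for all $\Phi\in\mathcal{D}$, and closed if $\mathcal{D}$ is complete in the graph norm $|||\Phi|||_Q^2=(1+a)\|\Phi\|^2\pm Q(\Phi)$ (sign $+$ for lower, $-$ for upper semibounded). The operator representing a closed semibounded $Q$ (Kato's representation theorem) is the unique self-adjoint semibounded operator $T$ with $\mathcal{D}(T)\subset\mathcal{D}$ and $Q(\Phi,\Psi)=\langle\Phi,T\Psi\rangle$ for all $\Phi\in\mathcal{D}$, $\Psi\in\mathcal{D}(T)$. The form $Q$ is $G$-invariant if $V(g)\mathcal{D}\subset\mathcal{D}$ and $Q(V(g)\Phi,V(g)\Psi)=Q(\Phi,\Psi)$ for all $g\in G$ and $\Phi,\Psi\in\mathcal{D}$. An operator $T$ with domain $\mathcal{D}(T)$ is $G$-invariant if $V(g)\mathcal{D}(T)\subset\mathcal{D}(T)$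 for all $g\in G$ and $V(g)T\Phi=TV(g)\Phi$ for all $g\in G$, $\Phi\in\mathcal{D}(T)$. *)

(* Defs.v *)
From HB Require Import structures.
From mathcomp Require Import all_boot all_order all_algebra.
From mathcomp Require Import sesquilinear.
From mathcomp Require Import all_real_closed.
From mathcomp Require Import all_classical all_reals all_analysis.

Set Implicit Arguments.
Unset Strict Implicit.
Unset Printing Implicit Defensive.

Import Order.TTheory GRing.Theory Num.Theory.
Import numFieldNormedType.Exports.

Local Open Scope classical_set_scope.
Local Open Scope ring_scope.
Local Open Scope complex_scope.

(* The norm of a normed module over R[i] takes its (real) values in R[i]. *)
HB.mixin Record isHilbert (R : realType) (V : Type)
    & CompleteNormedModule R[i] V := {
  hdot : {dot V for @Num.conj R[i]};
  hdot_norm : forall x : V, `|x| ^+ 2 = hdot x x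
}.

#[short(type="hilbertType")]
HB.structure Definition Hilbert (R : realType) :=
  {V of CompleteNormedModule R[i] V & isHilbert R V}.

HB.mixin Record isTopologicalGroup (G : Type) & Group G & Topological G := {
  mulg_continuous : continuous (fun p : G * G => (p.1 * p.2)%g);
  invg_continuous : continuous (fun g : G => (g^-1)%g)
}.

#[short(type="topologicalGroupType")]
HB.structure Definition TopologicalGroup :=
  {G of Group G & Topological G & isTopologicalGroup G}.

Section HilbertSpace.
Variables (R : realType) (H : hilbertType R).

(* The library's forms are linear in the first argument; the inner product
   [inner] is antilinear in the first argument and linear in the second. *)
Definition inner (x y : H) : R[i] := @hdot R H y x.

(* A Hermitian sesquilinear form on a subspace [fdom]. The values outside [fdom]
   are junk. Antilinearity in the first argument follows from [form_linear] and
   [form_hermitian]. *)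
Record qform := QForm {
  fdom : set H;
  form_val :> H -> H -> R[i];
  fdom_submod : submod_closed [in fdom];
  form_linear : forall x, fdom x ->
    forall a, {in fdom &, forall y z,
      form_val x (a *: y + z) = a * form_val x y + form_val x z};
  form_hermitian : {in fdom &, forall x y,
    form_val x y = Num.conj (form_val y x)}
}.

(* An unbounded operator, with domain the subspace [odom]; the values outside
   [odom] are junk. *)
Record operator := Operator {
  odom : set H;
  op_val :> H -> H;
  odom_submod : submod_closed [in odom];
  op_linear : forall a, {in odom &, forall x y,
    op_val (a *: x + y) = a *: op_val x + op_val y}
}.

(* In R[i], u <= v says that v - u is real and nonnegative. *)
Definition form_lower_bound (Q : qform) (a : R) : Prop :=
  0 < a /\ forall x, fdom Q x -> - a%:C * `|x| ^+ 2 <= Q x x.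

Definition form_upper_bound (Q : qform) (a : R) : Prop :=
  0 < a /\ forall x, fdom Q x -> Q x x <= a%:C * `|x| ^+ 2.

Definition form_semibounded (Q : qform) : Prop :=
  (exists a, form_lower_bound Q a) \/ (exists a, form_upper_bound Q a).

(* [Re] only changes the type from R[i] to R here: the radicand is real. *)
Definition lower_graph_norm (Q : qform) (a : R) (x : H) : R :=
  Num.sqrt (complex.Re ((1 + a)%:C * `|x| ^+ 2 + Q x x)).

Definition upper_graph_norm (Q : qform) (a : R) (x : H) : R :=
  Num.sqrt (complex.Re ((1 + a)%:C * `|x| ^+ 2 - Q x x)).

Definition complete_for (N : H -> R) (D : set H) : Prop :=
  forall u : nat -> H, (forall n, D (u n)) ->
  (forall e, 0 < e -> exists n0 : nat, forall m n : nat,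
     (n0 <= m)%N -> (n0 <= n)%N -> N (u m - u n) < e) ->
  exists2 x, D x & N (u n - x) @[n --> \oo] --> 0.

(* For different admissible bounds [a] the graph norms are equivalent. *)
Definition form_closed (Q : qform) : Prop :=
  (exists2 a, form_lower_bound Q a &
     complete_for (lower_graph_norm Q a) (fdom Q)) \/
  (exists2 a, form_upper_bound Q a &
     complete_for (upper_graph_norm Q a) (fdom Q)).

Definition op_semibounded (T : operator) : Prop :=
  (exists2 a : R, 0 < a &
     forall x, odom T x -> - a%:C * `|x| ^+ 2 <= inner x (T x)) \/
  (exists2 a : R, 0 < a &
     forall x, odom T x -> inner x (T x) <= a%:C * `|x| ^+ 2).

Definition op_graph (T : operator) : set (H * H) :=
  [set p | odom T p.1 /\ p.2 = T p.1].

(* The graph of the adjoint; it is single-valued when [T] is densely defined. *)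
Definition adjoint_graph (T : operator) : set (H * H) :=
  [set p | forall x, odom T x -> inner p.1 (T x) = inner p.2 x].

Definition self_adjoint (T : operator) : Prop :=
  dense (odom T) /\ adjoint_graph T = op_graph T.

(* By Kato's theorem exactly one [T] (up to its values outside [odom T])
   represents a densely defined closed semibounded [Q]. *)
Definition represents (T : operator) (Q : qform) : Prop :=
  [/\ self_adjoint T, op_semibounded T, odom T `<=` fdom Q &
      forall x y, fdom Q x -> odom T y -> Q x y = inner x (T y)].

Definition unitary (U : H -> H) : Prop :=
  (forall x y, inner (U x) (U y) = inner x y) /\ range U = setT.

Definition strongly_continuous_unitary_rep (G : topologicalGroupType)
    (V : G -> {linear H -> H}) : Prop :=
  [/\ forall g, unitary (V g),
      forall x, V 1%g x = x,
      forall g h x, V (g * h)%g x = V g (V h x) &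
      forall x, continuous (fun g => V g x)].

Definition form_invariant (G : Type) (V : G -> {linear H -> H})
    (Q : qform) : Prop :=
  forall g, V g @` fdom Q `<=` fdom Q /\
    forall x y, fdom Q x -> fdom Q y -> Q (V g x) (V g y) = Q x y.

Definition op_invariant (G : Type) (V : G -> {linear H -> H})
    (T : operator) : Prop :=
  forall g, V g @` odom T `<=` odom T /\
    forall x, odom T x -> V g (T x) = T (V g x).

End HilbertSpace.

(* Main.v *)
(* If Q is invariant and x is in D(T), then for y in D(T)
     <V x, T y> = Q(V x, y) = Q(x, V^-1 y) = <T x, V^-1 y> = <V T x, y>,
   so (V x, V T x) lies in the graph of the adjoint of T, which is T.
   Conversely, the energy form B = (1 + a)<.,.> +- Q dominates the squared norm
   and is complete on D. A vector of D that is B-orthogonal to D(T) lies in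
   D(T) by self-adjointness, and minimizing sequences for the B-distance to D(T)
   converge, so D(T) is B-dense in D. If x is the B-limit of y_n in D(T) and T is
   invariant, then V y_n is B-Cauchy; its B-limit is also its norm limit V x,
   which is therefore in D and has the same energy as x. Polarization
   concludes. *)
Require Import Defs.
From mathcomp Require Import all_boot all_order all_algebra.
From mathcomp Require Import sesquilinear.
From mathcomp Require Import all_real_closed.
From mathcomp Require Import all_classical all_reals all_analysis.
From mathcomp Require Import ring lra.

Set Implicit Arguments.
Unset Strict Implicit.
Unset Printing Implicit Defensive.

Import Order.TTheory GRing.Theory Num.Theory.
Import numFieldNormedType.Exports.

Local Open Scope classical_set_scope.
Local Open Scope ring_scope.
Local Open Scope complex_scope.

(* The variational inequality at the minimum gives a Cauchy-Schwarz inequality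
   with the excess [A - d] in place of [A]; [d = 0] is the usual one. *)
Lemma quadratic_min (R : realFieldType) (d A b c : R) :
  0 <= c -> (forall t, d <= A + t * b *+ 2 + t ^+ 2 * c) ->
  b ^+ 2 <= c * (A - d).
Proof.
move=> c_ge0 dmin; have [c0|c_neq0] := eqVneq c 0.
  have [->|b_neq0] := eqVneq b 0; first by rewrite c0 expr0n mul0r.
  (* For [c = 0] the bound is affine in [t]; this [t] brings it to [d - 1], below [d]. *)
  have := dmin ((d - A - 1) / (b *+ 2)).
  have -> : A + (d - A - 1) / (b *+ 2) * b *+ 2 = d - 1.
    by field.
  by rewrite c0 => ?; exfalso; lra.
have c_gt0 : 0 < c by rewrite lt_def c_neq0.
(* The vertex of the parabola. *)
have := dmin (- b / c).
have -> : A + - b / c * b *+ 2 + (- b / c) ^+ 2 * c = A - b ^+ 2 / c by field.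
move=> h; have {h} : b ^+ 2 / c <= A - d by lra.
by rewrite ler_pdivrMr // mulrC.
Qed.

(** * Real parts in [R[i]] *)

Section ComplexRe.
Variable R : realType.
Implicit Types z w : R[i].

Lemma ReD z w : complex.Re (z + w) = complex.Re z + complex.Re w.
Proof. by case: z w => [? ?] []. Qed.

Lemma ReZ (t : R) z : complex.Re (t%:C * z) = t * complex.Re z.
Proof. by case: z => a b /=; rewrite mul0r subr0. Qed.

Lemma Re_conj z : complex.Re (Num.conj z) = complex.Re z.
Proof. by case: z. Qed.

Lemma Re_mulNi z : complex.Re (- 'i * z) = complex.Im z.
Proof. by case: z => a b /=; ring. Qed.

Lemma conj_real (t : R) : Num.conj t%:C = t%:C.
Proof. exact: conjc_real. Qed.

Lemma Re_ge z w : z <= w -> complex.Re z <= complex.Re w.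
Proof. by rewrite lecE => /andP[]. Qed.

End ComplexRe.

Section Subspace.
Variables (R : realType) (H : hilbertType R) (M : set H).
Hypothesis Msub : submod_closed [in M].

Lemma submodZ a x : M x -> M (a *: x).
Proof.
case: Msub => M0 Mlin Mx.
by have := Mlin a x 0 (mem_set Mx) M0; rewrite addr0 => /set_mem.
Qed.

Lemma submodD x y : M x -> M y -> M (x + y).
Proof.
case: Msub => _ Mlin Mx My.
by have := Mlin 1 x y (mem_set Mx) (mem_set My); rewrite scale1r => /set_mem.
Qed.

Lemma submodB x y : M x -> M y -> M (x - y).
Proof. by move=> Mx My; rewrite -scaleN1r; apply/submodD/submodZ. Qed.

Lemma submod0 : M 0.
Proof. by case: Msub => /set_mem. Qed.

End Subspace.

(** * Calculus of Hermitian forms on a subspace *)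

Section Form.
Variables (R : realType) (H : hilbertType R) (B : qform H).
Local Notation D := (fdom B).
Local Notation reB x y := (complex.Re (B x y)).

Let DD := submodD (fdom_submod B).
Let DB := submodB (fdom_submod B).
Let DZ := submodZ (fdom_submod B).

Lemma formPr x y z a : D x -> D y -> D z -> B x (a *: y + z) = a * B x y + B x z.
Proof. by move=> ? ? ?; apply: form_linear => //; exact: mem_set. Qed.

Lemma formC x y : D x -> D y -> B x y = Num.conj (B y x).
Proof. by move=> ? ?; apply: form_hermitian; exact: mem_set. Qed.

Lemma formDr x y z : D x -> D y -> D z -> B x (y + z) = B x y + B x z.
Proof. by move=> ? ? ?; rewrite -[y]scale1r formPr // scale1r mul1r. Qed.

Lemma formZr x y a : D x -> D y -> B x (a *: y) = a * B x y.
Proof.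
move=> Dx Dy; have D0 := submod0 (fdom_submod B).
rewrite -[a *: y]addr0 formPr //.
suff -> : B x 0 = 0 by rewrite addr0.
by apply: (addrI (B x 0)); rewrite -formDr // !addr0.
Qed.

Lemma formBr x y z : D x -> D y -> D z -> B x (y - z) = B x y - B x z.
Proof.
move=> ? ? ?; rewrite -scaleN1r formDr ?formZr ?mulN1r //; exact: DZ.
Qed.

Lemma formDl x y z : D x -> D y -> D z -> B (x + y) z = B x z + B y z.
Proof.
by move=> ? ? ?; rewrite (formC (DD _ _)) // formDr // rmorphD /= -!formC.
Qed.

Lemma formZl x y a : D x -> D y -> B (a *: x) y = Num.conj a * B x y.
Proof.
by move=> ? ?; rewrite (formC (DZ _ _)) // formZr // rmorphM /= -formC.
Qed.

Lemma reformC x y : D x -> D y -> reB x y = reB y x.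
Proof. by move=> ? ?; rewrite formC // Re_conj. Qed.

Lemma reform_expand x y (t : R) : D x -> D y ->
  reB (x + t%:C *: y) (x + t%:C *: y) = reB x x + t * reB x y *+ 2 + t ^+ 2 * reB y y.
Proof.
move=> Dx Dy; have Dty : D (t%:C *: y) by exact: DZ.
rewrite formDr ?formDl //; last exact: DD.
rewrite !formZr ?formZl // conj_real !ReD !ReZ (reformC Dy Dx); ring.
Qed.

Lemma reformD x y : D x -> D y ->
  reB (x + y) (x + y) = reB x x + reB x y *+ 2 + reB y y.
Proof.
by move=> Dx Dy; have := reform_expand 1 Dx Dy; rewrite scale1r expr1n !mul1r.
Qed.

Lemma reformB x y : D x -> D y ->
  reB (x - y) (x - y) = reB x x - reB x y *+ 2 + reB y y.
Proof.
move=> Dx Dy; have := reform_expand (- 1) Dx Dy.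
by rewrite rmorphN1 scaleN1r sqrrN expr1n mulN1r mul1r mulNrn.
Qed.

Lemma reformBC x y : D x -> D y -> reB (x - y) (x - y) = reB (y - x) (y - x).
Proof. by move=> Dx Dy; rewrite !reformB // (reformC Dx Dy); ring. Qed.

Lemma reformZ x (t : R) : D x -> reB (t%:C *: x) (t%:C *: x) = t ^+ 2 * reB x x.
Proof.
by move=> Dx; rewrite formZr ?formZl ?conj_real ?ReZ ?expr2 ?mulrA //; exact: DZ.
Qed.

(** Turns statements about imaginary parts into statements about real parts on a complex
    subspace. *)
Lemma imformE x y : D x -> D y -> complex.Im (B x y) = reB x (- 'i *: y).
Proof. by move=> Dx Dy; rewrite formZr // Re_mulNi. Qed.

(** Energies of [x], [y] and [x + y] determine the real part of [B x y]; the imaginary part is the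
    real part at [- 'i *: y], and [U] commutes with that scaling. *)
Lemma form_polarization (U : {linear H -> H}) :
  (forall x, D x -> D (U x)) -> (forall x, D x -> reB (U x) (U x) = reB x x) ->
  forall x y, D x -> D y -> B (U x) (U y) = B x y.
Proof.
move=> UD Uq.
have Ure x y : D x -> D y -> reB (U x) (U y) = reB x y.
  move=> Dx Dy; have := Uq _ (DD Dx Dy).
  rewrite linearD !reformD ?Uq //; try exact: UD.
  by move=> ?; lra.
move=> x y Dx Dy; apply/eqP; rewrite eq_complex Ure // eqxx /=.
by rewrite !imformE -?linearZ ?Ure //; [exact: DZ | exact: UD | exact: UD].
Qed.

(** * Projection argument for a complete nonnegative form *)

Section Energy.

Hypothesis B_ge0 : forall x, D x -> 0 <= reB x x.
Hypothesis B_complete : complete_for (fun x => Num.sqrt (reB x x)) D.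

(** Completeness rephrased with squared energies, so that later estimates avoid square roots. *)
Lemma energy_limit (u : nat -> H) : (forall n, D (u n)) ->
  (forall e, 0 < e -> exists n0, forall m n, (n0 <= m)%N -> (n0 <= n)%N ->
     reB (u m - u n) (u m - u n) < e) ->
  exists2 z, D z & forall e, 0 < e ->
    exists n0, forall n, (n0 <= n)%N -> reB (u n - z) (u n - z) < e.
Proof.
move=> Du uC; have [|z Dz uz] := B_complete Du.
  move=> e e0; have [|n0 n0P] := uC (e ^+ 2); first exact: exprn_gt0.
  exists n0 => m n mn0 nn0.
  by rewrite -(ger0_norm (ltW e0)) -sqrtr_sqr ltr_sqrt ?n0P ?exprn_gt0.
exists z => // e e0.
have /cvgr0Pnorm_lt/(_ (Num.sqrt e)) := uz; rewrite sqrtr_gt0 => /(_ e0)[n0 _ n0P].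
exists n0 => n /n0P /=; rewrite ger0_norm ?sqrtr_ge0 // ltr_sqrt //.
Qed.

Lemma energy_CauchySchwarz x y : D x -> D y ->
  reB x y ^+ 2 <= reB x x * reB y y.
Proof.
move=> Dx Dy; rewrite mulrC -[X in _ * X]subr0; apply: quadratic_min; first exact: B_ge0.
by move=> t; rewrite -reform_expand //; apply: B_ge0; exact/DD/DZ.
Qed.

(** A minimizing sequence in [M] for the distance to [x] converges to some [z], which is only known
    to lie in [D]. The residual [x - z] is orthogonal to [M], hence in [M] by the third hypothesis,
    hence orthogonal to itself. *)
Lemma energy_dense (M : set H) : submod_closed [in M] -> M `<=` D ->
  (forall x, D x -> (forall y, M y -> B x y = 0) -> M x) ->
  forall x, D x -> forall e, 0 < e ->
  exists2 y, M y & reB (x - y) (x - y) < e.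
Proof.
move=> Msub MD MT x Dx.
have MZ := submodZ Msub; have MDd := submodD Msub; have M0 := submod0 Msub.
pose S := [set reB (x - y) (x - y) | y in M].
have Sinf : has_inf S.
  split; first by exists (reB (x - 0) (x - 0)), 0.
  by exists 0 => _ [y My <-]; apply: B_ge0; apply: DB => //; exact: MD.
pose d := inf S.
have dS y : M y -> d <= reB (x - y) (x - y).
  by move=> My; apply: ge_inf; [case: Sinf | exists y].
have /boolp.choice[y yP] (n : nat) :
    exists y, M y /\ reB (x - y) (x - y) < d + n.+1%:R^-1.
  have [|_ [y My <-] yd] := @inf_adherent _ S n.+1%:R^-1 _ Sinf.
    by rewrite invr_gt0.
  by exists y.
have My n : M (y n) by case: (yP n).
have Dxy n : D (x - y n) by apply: DB => //; exact: MD.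
have yd e : 0 < e -> exists n0, forall n, (n0 <= n)%N ->
    reB (x - y n) (x - y n) < d + e.
  move=> e0; have [n0 n0P] : exists n0 : nat, n0.+1%:R^-1 < e.
    exists (Num.truncn e^-1).
    by rewrite invf_plt ?posrE // truncnS_gt.
  exists n0 => n n0n; apply: lt_trans (_ : d + n.+1%:R^-1 < _); first by case: (yP n).
  rewrite ltrD2l; apply: le_lt_trans n0P.
  by rewrite lef_pV2 ?posrE ?ltr0n // ler_nat.
have [||z Dz yz] := @energy_limit y.
- by move=> n; exact: MD.
(* Parallelogram law: the midpoint of [y m] and [y n] is in [M], so its squared distance to [x] is
   at least [d]. Two excesses below [e / 4] then bound the energy of [y m - y n] by [e]. *)
- move=> e e0; have [|n0 n0P] := yd (e / 4); first by rewrite divr_gt0.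
  exists n0 => m n /n0P mP /n0P nP.
  have Mmid : M (2^-1%:C *: (y m + y n)) by exact/MZ/MDd.
  have := dS _ Mmid.
  have -> : x - 2^-1%:C *: (y m + y n) = 2^-1%:C *: ((x - y m) + (x - y n)).
    rewrite addrACA -opprD scalerBr -[X in X + X]scale1r -scalerDl scalerA.
    rewrite [_ * _](_ : _ = 1) ?scale1r //.
    rewrite -(rmorph1 (real_complex R)) -rmorphD -rmorphM mulVf ?rmorph1 //.
  rewrite (reformZ _ (DD (Dxy m) (Dxy n))) (reformD (Dxy m) (Dxy n)).
  have -> : y m - y n = (x - y n) - (x - y m) by rewrite opprB [RHS]addrC addrA subrK.
  rewrite (reformB (Dxy n) (Dxy m)) (reformC (Dxy n) (Dxy m)).
  move: mP nP.
  move: (reB (x - y m) _) (reB (x - y n) (x - y n)) (reB (x - y m) (x - y n)).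
  move=> a b c *; lra.
have orth v : M v -> reB (x - z) v = 0.
  move=> Mv; apply/eqP; rewrite -sqrf_eq0 eq_le sqr_ge0 andbT.
  have Dv := MD _ Mv; have v_ge0 := B_ge0 Dv.
  apply/ler_addgt0Pl => e e0; rewrite addr0.
  (* Chosen so that [4 * reB v v * e' <= e]; the added 1 covers [reB v v = 0]. *)
  pose e' := e / (4 * (1 + reB v v)).
  have e'0 : 0 < e' by rewrite /e' divr_gt0 ?mulr_gt0 // ltr_wpDr.
  have [n1 n1P] := yd _ e'0; have [n2 n2P] := yz _ e'0.
  pose n := maxn n1 n2.
  have Dyz : D (y n - z) by apply: DB => //; exact: MD.
  have -> : x - z = (x - y n) + (y n - z) by rewrite addrA subrK.
  rewrite formDl // ReD.
  (* Moving [y n] along [v] stays in [M] and cannot lower the squared distance below [d], so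
     near-minimality makes [x - y n] nearly orthogonal to [v]. *)
  have h1 : reB (x - y n) v ^+ 2 <= reB v v * e'.
    apply: le_trans (_ : _ <= reB v v * (reB (x - y n) (x - y n) - d)) _.
      apply: quadratic_min => // t; rewrite -reform_expand //.
      rewrite -[t%:C]opprK scaleNr -addrA -opprD; apply: dS.
      exact/MDd/MZ.
    rewrite ler_wpM2l // lerBlDl; exact/ltW/n1P/leq_maxl.
  have h2 : reB (y n - z) v ^+ 2 <= reB v v * e'.
    apply: le_trans (energy_CauchySchwarz Dyz Dv) _.
    by rewrite mulrC ler_wpM2l //; exact/ltW/n2P/leq_maxr.
  have h3 : (reB v v + 1) * e' = e / 4.
    by rewrite /e' addrC; field; rewrite gt_eqF // ltr_wpDr.
  have h4 : (reB (x - y n) v + reB (y n - z) v) ^+ 2 <=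
     reB (x - y n) v ^+ 2 *+ 2 + reB (y n - z) v ^+ 2 *+ 2.
    rewrite -subr_ge0; have := sqr_ge0 (reB (x - y n) v - reB (y n - z) v).
    by congr (_ <= _); ring.
  lra.
have Dxz : D (x - z) by exact: DB.
have Mxz : M (x - z).
  (* The imaginary part vanishes by [orth] at [- 'i *: v], which is again in [M]. *)
  apply: MT => // v Mv; apply/eqP; rewrite eq_complex /= imformE ?orth ?eqxx //.
    exact: MZ.
  exact: MD.
move=> e e0; have [n0 n0P] := yz _ e0.
exists (y n0); first exact: My.
have -> : x - y n0 = (x - z) - (y n0 - z) by rewrite opprB addrA subrK.
rewrite reformB //; last by apply: DB => //; exact: MD.
(* [B] may be degenerate here, so [x = z] is not claimed: zero energy and Cauchy-Schwarz remove
   every term involving [x - z]. *)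
have -> : reB (x - z) (x - z) = 0 by exact: orth.
have Dyz : D (y n0 - z) by apply: DB => //; exact: MD.
have -> : reB (x - z) (y n0 - z) = 0.
  apply/eqP; rewrite -sqrf_eq0 eq_le sqr_ge0 andbT.
  by apply: le_trans (energy_CauchySchwarz Dxz Dyz) _; rewrite orth ?mul0r.
by rewrite mul0rn subrr add0r n0P.
Qed.

(** Parallelogram law with the nonnegative energy of [x - y] dropped; it replaces the triangle
    inequality for squared norms. *)
Lemma energy_quasi_triangle x y : D x -> D y ->
  reB (x + y) (x + y) <= reB x x *+ 2 + reB y y *+ 2.
Proof.
move=> Dx Dy; have := B_ge0 (DB Dx Dy); rewrite reformB // reformD //.
move: (reB x x) (reB x y) (reB y y) => a b c *; lra.
Qed.

End Energy.
End Form.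

(** * The inner product as an instance of the form calculus *)

Section Inner.
Variables (R : realType) (H : hilbertType R).
Implicit Types x y z : H.

Lemma innerPr x a y z : inner x (a *: y + z) = a * inner x y + inner x z.
Proof. by rewrite /inner linearPl. Qed.

Lemma innerC x y : inner x y = Num.conj (inner y x).
Proof. by rewrite /inner hermC expr0 mul1r. Qed.

Lemma inner_norm x : inner x x = `|x| ^+ 2.
Proof. by rewrite hdot_norm. Qed.

Lemma setT_submod : submod_closed [in [set: H]].
Proof. by split=> [|a x y _ _]; exact: mem_set. Qed.

Definition inner_form : qform H :=
  {| fdom := [set: H]; form_val := @inner R H; fdom_submod := setT_submod;
     form_linear := fun x _ a y z _ _ => innerPr x a y z;
     form_hermitian := fun x y _ _ => innerC x y |}.

Lemma innerZl a x y : inner (a *: x) y = Num.conj a * inner x y.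
Proof. exact: (@formZl _ _ inner_form). Qed.

Lemma inner_ge0 x : 0 <= complex.Re (inner x x).
Proof. by apply: (@Re_ge _ 0); rewrite inner_norm exprn_ge0. Qed.

Lemma inner_eq0 x : complex.Re (inner x x) = 0 -> x = 0.
Proof.
move=> x0; apply/eqP; rewrite -normr_eq0 -sqrf_eq0 -inner_norm.
have : 0 <= inner x x by rewrite inner_norm exprn_ge0.
by move: x0; case: (inner x x) => a b /= ->; rewrite lecE /= => /andP[/eqP-> _].
Qed.

End Inner.

(** * Invariance of the energy extended from a dense subspace *)

Section Invariance.
Variables (R : realType) (H : hilbertType R) (B : qform H) (M : set H).
Variable U : {linear H -> H}.
Local Notation D := (fdom B).
Local Notation reB x y := (complex.Re (B x y)).
Local Notation reI x y := (complex.Re (inner x y)).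
Hypothesis B_ge_inner : forall x, D x -> reI x x <= reB x x.
Hypothesis B_complete : complete_for (fun x => Num.sqrt (reB x x)) D.
Hypothesis MD : M `<=` D.
Hypothesis M_dense : forall x, D x -> forall e, 0 < e ->
  exists2 y, M y & reB (x - y) (x - y) < e.
Hypothesis U_inner : forall x, inner (U x) (U x) = inner x x.
Hypothesis UM : forall y, M y -> M (U y).
Hypothesis UB : forall x y, D x -> D (U x) -> M y -> B (U x) (U y) = B x y.

Let B_ge0 x : D x -> 0 <= reB x x.
Proof. by move=> Dx; apply: le_trans (B_ge_inner Dx); exact: inner_ge0. Qed.

Let DB := submodB (fdom_submod B).

(** The images [U (y n)] of an approximating sequence in [M] are Cauchy in energy, because [U]
    preserves the energy on [M]. Energy convergence implies norm convergence, so their limit is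
    [U x]. *)
Lemma energy_isometry_approx x : D x ->
  D (U x) /\ forall e, 0 < e -> exists2 y, M y &
    reB (x - y) (x - y) < e /\ reB (U x - U y) (U x - U y) < e.
Proof.
move=> Dx.
have /boolp.choice[y yP] (n : nat) :
    exists y, M y /\ reB (x - y) (x - y) < n.+1%:R^-1.
  by have [|y My yx] := M_dense Dx (e := n.+1%:R^-1); [rewrite invr_gt0 | exists y].
have My n : M (y n) by case: (yP n).
have Dy n : D (y n) by exact: MD.
have Dxy n : D (x - y n) by exact: DB.
have DUy n : D (U (y n)) by exact/MD/UM.
have yx e : 0 < e -> exists n0, forall n, (n0 <= n)%N -> reB (x - y n) (x - y n) < e.
  move=> e0; exists (Num.truncn e^-1) => n n0n.
  apply: lt_trans (_ : n.+1%:R^-1 < _); first by case: (yP n).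
  rewrite invf_plt ?posrE //; apply: lt_le_trans (truncnS_gt _) _.
  by rewrite ler_nat.
have [||z Dz Uyz] := @energy_limit _ _ _ B_complete (U \o y) => /=.
- exact: DUy.
- move=> e e0; have [|n0 n0P] := yx (e / 4); first by rewrite divr_gt0.
  exists n0 => m n /n0P mP /n0P nP.
  have -> : reB (U (y m) - U (y n)) (U (y m) - U (y n)) =
            reB (y m - y n) (y m - y n).
    by rewrite !reformB // !UB.
  have -> : y m - y n = (x - y n) - (x - y m) by rewrite opprB [RHS]addrC addrA subrK.
  rewrite reformB //; have := B_ge0 (submodD (fdom_submod B) (Dxy n) (Dxy m)).
  rewrite reformD //; move: mP nP.
  move: (reB (x - y m) _) (reB (x - y n) (x - y n)) (reB (x - y n) (x - y m)).
  move=> a b c *; lra.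
(* Both [U x] and [z] are norm limits of [U (y n)]: the first since [U] is isometric, the second
   since [B] dominates the inner product. *)
have zE : U x = z.
  apply/eqP; rewrite -subr_eq0; apply/eqP/inner_eq0/eqP.
  rewrite eq_le inner_ge0 andbT; apply/ler_addgt0Pl => e e0; rewrite addr0.
  have e4 : 0 < e / 4 by rewrite divr_gt0.
  have [n1 n1P] := yx _ e4; have [n2 n2P] := Uyz _ e4.
  pose n := maxn n1 n2.
  have -> : U x - z = U (x - y n) + (U (y n) - z) by rewrite linearB addrA subrK.
  apply: le_trans (@energy_quasi_triangle _ _ (inner_form H) _ _ _ _ _) _ => //.
    by move=> v _; exact: inner_ge0.
  rewrite /= U_inner.
  have := le_lt_trans (B_ge_inner (Dxy n)) (n1P _ (leq_maxl n1 n2)).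
  have := le_lt_trans (B_ge_inner (DB (DUy n) Dz)) (n2P _ (leq_maxr n1 n2)).
  move: (reI (x - y n) _) (reI (U (y n) - z) _) => a b *; lra.
rewrite zE; split=> //.
move=> e e0; have [n1 n1P] := yx _ e0; have [n2 n2P] := Uyz _ e0.
exists (y (maxn n1 n2)) => //; split; first exact/n1P/leq_maxl.
by rewrite reformBC //; exact/n2P/leq_maxr.
Qed.

(** In the expanded energies of [x - y] and [U x - U y], the terms involving [y] agree by [UB]. The
    energies of [x] and [U x] thus differ by the difference of two numbers in [[0, e)]. *)
Lemma energy_invariant x : D x -> D (U x) /\ reB (U x) (U x) = reB x x.
Proof.
move=> Dx; have [DUx approx] := energy_isometry_approx Dx; split=> //.
apply/eqP; rewrite -subr_eq0 -normr_le0; apply/ler_addgt0Pl => e e0; rewrite addr0.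
have [y My [xy Uxy]] := approx _ e0.
have Dy := MD My; have DUy := MD (UM My).
have xy0 := B_ge0 (DB Dx Dy); have Uxy0 := B_ge0 (DB DUx DUy).
move: xy Uxy xy0 Uxy0; rewrite !reformB // (UB Dx DUx My) (UB Dy DUy My).
move: (reB (U x) _) (reB x x) (reB x y) (reB y y) => a b c d *.
rewrite ler_norml; apply/andP; split; lra.
Qed.

End Invariance.

(** * Transfer between the form and its representing operator *)

Section Representation.
Variables (R : realType) (H : hilbertType R) (Q : qform H) (T : operator H).
Hypothesis TQ : represents T Q.

Lemma represents_graph x z :
  (forall y, odom T y -> inner x (T y) = inner z y) -> odom T x /\ z = T x.
Proof.
case: TQ => [[_ Tadj] _ _ _] xz.
have : adjoint_graph T (x, z) by [].
by rewrite Tadj.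
Qed.

(** [U'] plays the role of the inverse of [U]: it carries [y] back into the form domain, and the
    resulting identity puts [(U x, U (T x))] in the graph of the adjoint. *)
Lemma op_invariant_of_form (U U' : {linear H -> H}) :
  (forall x y, inner (U x) (U y) = inner x y) -> cancel U' U ->
  (forall x, fdom Q x -> fdom Q (U x)) -> (forall x, fdom Q x -> fdom Q (U' x)) ->
  (forall x y, fdom Q x -> fdom Q y -> Q (U x) (U y) = Q x y) ->
  forall x, odom T x -> odom T (U x) /\ U (T x) = T (U x).
Proof.
move=> Uiso UK UD U'D UQ x Tx; apply: represents_graph => y Ty.
have [_ _ TD QT] := TQ; have Dx := TD _ Tx; have Dy := TD _ Ty.
rewrite -QT //; last exact: UD.
rewrite -{1}[y]UK UQ //; last exact: U'D.
(* The representation formula needs the vector of [odom T] in the second slot, hence the swap. *)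
rewrite formC ?QT //; [|exact: U'D|exact: U'D].
by rewrite -innerC -Uiso UK.
Qed.

Section Energy.
Variables c s : R.
Hypothesis s2 : s ^+ 2 = 1.

(** With [c = 1 + a] and [s] equal to 1 or -1 this is the squared graph norm on the diagonal, in the
    lower or upper bounded case; [s2] treats both signs at once. *)
Let energy_val x y := c%:C * inner x y + s%:C * Q x y.

Lemma energy_linear x : fdom Q x -> forall a, {in fdom Q &, forall y z,
  energy_val x (a *: y + z) = a * energy_val x y + energy_val x z}.
Proof.
move=> Dx a y z Dy Dz; rewrite /energy_val innerPr form_linear //; ring.
Qed.

Lemma energy_hermitian : {in fdom Q &, forall x y,
  energy_val x y = Num.conj (energy_val y x)}.
Proof.
move=> x y Dx Dy.
by rewrite /energy_val rmorphD !rmorphM /= !conj_real -innerC -form_hermitian.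
Qed.

Definition energy : qform H := QForm (fdom_submod Q) energy_linear energy_hermitian.

(** Since [s ^+ 2 = 1], orthogonality reads [<x, T y> = - c s <x, y>], so [x] is in the domain of
    the adjoint of [T], with value [- c s x]. *)
Lemma energy_orth x : fdom Q x -> (forall y, odom T y -> energy x y = 0) ->
  odom T x.
Proof.
move=> Dx orth; have [_ _ _ QT] := TQ.
apply: (proj1 (@represents_graph x ((- (c * s))%:C *: x) _)) => y Ty.
have /eqP := orth _ Ty; rewrite /= /energy_val QT // addr_eq0 => /eqP cs.
rewrite innerZl conj_real rmorphN rmorphM /= mulNr mulrAC cs.
by rewrite mulNr opprK mulrAC -rmorphM -expr2 s2 mul1r.
Qed.

Hypothesis energy_ge_inner : forall x, fdom Q x ->
  complex.Re (inner x x) <= complex.Re (energy x x).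
Hypothesis energy_complete :
  complete_for (fun x => Num.sqrt (complex.Re (energy x x))) (fdom Q).

Lemma form_invariant_of_op (U : {linear H -> H}) :
  (forall x y, inner (U x) (U y) = inner x y) ->
  (forall x, odom T x -> odom T (U x) /\ U (T x) = T (U x)) ->
  (forall x, fdom Q x -> fdom Q (U x)) /\
  forall x y, fdom Q x -> fdom Q y -> Q (U x) (U y) = Q x y.
Proof.
move=> Uiso UT; have [_ _ TD QT] := TQ.
have E_ge0 x : fdom Q x -> 0 <= complex.Re (energy x x).
  by move=> Dx; apply: le_trans (energy_ge_inner Dx); exact: inner_ge0.
(* With [y] in [odom T], [Q (U x) (U y)] is [<U x, T (U y)> = <U x, U (T y)>], where [U] drops
   out. *)
have UB x y : fdom Q x -> fdom Q (U x) -> odom T y ->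
    energy (U x) (U y) = energy x y.
  move=> Dx DUx Ty; have [TUy UTy] := UT _ Ty.
  by rewrite /= /energy_val Uiso !QT // -UTy Uiso.
have Uinv x : fdom Q x ->
    fdom Q (U x) /\ complex.Re (energy (U x) (U x)) = complex.Re (energy x x).
  apply: (@energy_invariant _ _ energy (odom T)) => //.
  - exact: (energy_dense (B := energy) E_ge0 energy_complete (odom_submod T) TD
              energy_orth).
  - by move=> y /UT[].
have UD x : fdom Q x -> fdom Q (U x) by case/Uinv.
split=> // x y Dx Dy.
have := form_polarization (B := energy) UD (fun x Dx => proj2 (Uinv x Dx)) Dx Dy.
(* The inner products cancel, and [s] is nonzero because its square is 1. *)
rewrite /= /energy_val Uiso => /addrI /mulfI; apply.
rewrite -(rmorph0 (real_complex R)) (inj_eq (@complexI _)).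
by apply: contra_eq_neq s2 => ->; rewrite expr0n /= eq_sym oner_neq0.
Qed.

End Energy.
End Representation.

(** * Both implications for the representation *)

Theorem theorem6p5 (R : realType) (H : hilbertType R)
    (G : topologicalGroupType) (V : G -> {linear H -> H})
    (hV : strongly_continuous_unitary_rep V)
    (Q : qform H) (hdense : dense (fdom Q))
    (hsemi : form_semibounded Q) (hclosed : form_closed Q)
    (T : operator H) (hT : represents T Q) :
  form_invariant V Q <-> op_invariant V T.
Proof.
have [Vunit V1 VM _] := hV.
have Viso g x y : inner (V g x) (V g y) = inner x y by case: (Vunit g).
have VK g : cancel (V g^-1%g) (V g) by move=> x; rewrite -VM mulgV V1.
split=> [QV g|TV g].
  have VD h x : fdom Q x -> fdom Q (V h x).
    by move=> Dx; apply: (proj1 (QV h)); exists x.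
  (* The form domain must be preserved by both [g] and its inverse. *)
  have VT := op_invariant_of_form hT (Viso g) (VK g) (VD g) (VD _)
               (proj2 (QV g)).
  by split=> [_ [x Tx <-]|x /VT[]//]; case: (VT _ Tx).
have VT x : odom T x -> odom T (V g x) /\ V g (T x) = T (V g x).
  by have [Tg gT] := TV g; split; [apply: Tg; exists x | exact: gT].
suff [VD VQ] : (forall x, fdom Q x -> fdom Q (V g x)) /\
    forall x y, fdom Q x -> fdom Q y -> Q (V g x) (V g y) = Q x y.
  by split=> // _ [x Dx <-]; exact: VD.
(* In each case the bound [a] absorbs the signed [Q], and the 1 in [1 + a] leaves the squared norm
   as a lower bound for the energy. *)
case: hclosed => [[a [a0 Qa] Qcomplete]|[a [a0 Qa] Qcomplete]].
- apply: (form_invariant_of_op hT (c := 1 + a) (s := 1)) (Viso g) VT.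
  + by rewrite expr1n.
  + move=> x Dx; have := Re_ge (Qa _ Dx).
    rewrite -inner_norm -[- _]rmorphN !ReZ /= ReD !ReZ.
    move: (complex.Re _) (complex.Re _) => u v; lra.
  + congr complete_for: Qcomplete; apply/funext => x.
    by rewrite /lower_graph_norm /= -inner_norm mul1r.
- apply: (form_invariant_of_op hT (c := 1 + a) (s := -1)) (Viso g) VT.
  + by rewrite sqrrN expr1n.
  + move=> x Dx; have := Re_ge (Qa _ Dx).
    rewrite -inner_norm /= ReD !ReZ.
    move: (complex.Re _) (complex.Re _) => u v; lra.
  + congr complete_for: Qcomplete; apply/funext => x.
    by rewrite /upper_graph_norm /= -inner_norm rmorphN1 mulN1r.
Qed.
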